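(* Let $X$ and $Y$ be independent generalised random variables on $\mathbb{R}$ with pairs $(T_1,\varphi_1)$ and $(T_2,\varphi_2)$. If ${}^{(\varphi_1)}\phi_X(0)\ne0$ and ${}^{(\varphi_2)}\phi_Y(0)\ne0$, then for all $n\ge1$ $${}^{(\varphi)}\kappa_n(X+Y)={}^{(\varphi_1)}\kappa_n(X)+{}^{(\varphi_2)}\kappa_n(Y).$$
   Context: $\mathcal{S}$, $\mathcal{S}'$ denote Schwartz functions and tempered distributions. A generalised random variable on $\mathbb{R}$ is specified by a pair $(T,\varphi)$, $T\in\mathcal{S}'(\mathbb{R})$, $\varphi\in\mathcal{S}(\mathbb{R})$; its weak characteristic function is ${}^{(\varphi)}\phi(t):=\langle T,e^{itx}\varphi(x)\rangle$. Independence of $X$ and $Y$ means that the joint representation is the tensor product pair $(T_1\otimes T_2,\varphi_1\otimes\varphi_2)$ on $\mathbb{R}^2$, and the weak characteristic function of $X+Y$ is ${}^{(\varphi)}\phi_{X+Y}(t):=\langle T_1\otimes T_2,e^{it(x+y)}\varphi_1(x)\varphi_2(y)\rangle$. When a weak characteristic function ${}^{(\varphi)}\phi$ is nonzero near $0$, the weak cumulant generating function is ${}^{(\varphi)}K(t):=\log{}^{(\varphi)}\phi(t)$ (any continuous branch near $0$), and the $n$-th weak cumulant ($n\ge1$) is ${}^{(\varphi)}\kappa_n:=i^{-n}\frac{d^n}{dt^n}{}^{(\varphi)}K(t)\big|_{t=0}$. *)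

(* Defs.v *)
From Stdlib Require Import Reals ClassicalEpsilon.
From Coquelicot Require Import Coquelicot.

Open Scope R_scope.

Definition Cexp (z : C) : C := (exp (Re z) * cos (Im z), exp (Re z) * sin (Im z)).

(** * Derivatives of complex-valued functions of real variables *)

Definition ex_Cderive_n (f : R -> C) (n : nat) (x : R) : Prop :=
  ex_derive_n (fun t => Re (f t)) n x /\ ex_derive_n (fun t => Im (f t)) n x.

Definition Cderive_n (f : R -> C) (n : nat) (x : R) : C :=
  (Derive_n (fun t => Re (f t)) n x, Derive_n (fun t => Im (f t)) n x).

Definition Csmooth_2d (f : R -> R -> C) : Prop :=
  forall (n : nat) (x y : R),
    ex_diff_n (fun u v => Re (f u v)) n x y /\
    ex_diff_n (fun u v => Im (f u v)) n x y.

Definition Cpartial (a b : nat) (f : R -> R -> C) (x y : R) : C :=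
  (partial_derive a b (fun u v => Re (f u v)) x y,
   partial_derive a b (fun u v => Im (f u v)) x y).

(** * Schwartz functions on R and on R^2 *)

(* [seminorm_le k n f M] says that sup_x |x|^k |f^(n)(x)| <= M. *)
Definition seminorm_le (k n : nat) (f : R -> C) (M : R) : Prop :=
  forall x : R, Rabs x ^ k * Cmod (Cderive_n f n x) <= M.

Definition schwartz (f : R -> C) : Prop :=
  (forall (n : nat) (x : R), ex_Cderive_n f n x) /\
  (forall k n : nat, exists M : R, seminorm_le k n f M).

Definition seminorm2_le (k l a b : nat) (f : R -> R -> C) (M : R) : Prop :=
  forall x y : R, Rabs x ^ k * Rabs y ^ l * Cmod (Cpartial a b f x y) <= M.

Definition schwartz2 (f : R -> R -> C) : Prop :=
  Csmooth_2d f /\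
  (forall k l a b : nat, exists M : R, seminorm2_le k l a b f M).

(** * Tempered distributions on R and on R^2 *)

(* A distribution is encoded as a total functional on all functions, of which
   only the values on Schwartz functions are constrained (and used).
   Continuity is continuity for the topology of the Schwartz seminorms: the sets
   of [g] all of whose seminorms of order at most [N] satisfy p(g - f) <= delta
   form a neighbourhood basis of [f]. *)
Definition tempered (T : (R -> C) -> C) : Prop :=
  (forall (a b : C) (f g : R -> C), schwartz f -> schwartz g ->
     T (fun x => (a * f x + b * g x)%C) = (a * T f + b * T g)%C) /\
  (forall f : R -> C, schwartz f -> forall eps : R, 0 < eps ->
     exists (N : nat) (delta : R), 0 < delta /\
       forall g : R -> C, schwartz g ->
         (forall k n : nat, (k <= N)%nat -> (n <= N)%nat ->
            seminorm_le k n (fun x => (g x - f x)%C) delta) ->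
         Cmod (T g - T f)%C < eps).

Definition tempered2 (T : (R -> R -> C) -> C) : Prop :=
  (forall (a b : C) (f g : R -> R -> C), schwartz2 f -> schwartz2 g ->
     T (fun x y => (a * f x y + b * g x y)%C) = (a * T f + b * T g)%C) /\
  (forall f : R -> R -> C, schwartz2 f -> forall eps : R, 0 < eps ->
     exists (N : nat) (delta : R), 0 < delta /\
       forall g : R -> R -> C, schwartz2 g ->
         (forall k l a b : nat,
            (k <= N)%nat -> (l <= N)%nat -> (a <= N)%nat -> (b <= N)%nat ->
            seminorm2_le k l a b (fun x y => (g x y - f x y)%C) delta) ->
         Cmod (T g - T f)%C < eps).

(* For tempered [T1] and [T2], T1 (x) T2 is the tempered distribution on R^2
   with this property; it exists and is unique on Schwartz functions. *)
Definition is_tensor (T : (R -> R -> C) -> C) (T1 T2 : (R -> C) -> C) : Prop :=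
  tempered2 T /\
  forall f g : R -> C, schwartz f -> schwartz g ->
    T (fun x y => (f x * g y)%C) = (T1 f * T2 g)%C.

(** * Generalised random variables *)

Record grv : Type := Grv {
  grv_dist : (R -> C) -> C;
  grv_test : R -> C;
  grv_dist_tempered : tempered grv_dist;
  grv_test_schwartz : schwartz grv_test
}.

(* A generalised random vector (X, Y) in R^2. *)
Record grv2 : Type := Grv2 {
  grv2_dist : (R -> R -> C) -> C;
  grv2_test : R -> R -> C;
  grv2_dist_tempered : tempered2 grv2_dist;
  grv2_test_schwartz : schwartz2 grv2_test
}.

Definition weak_char (X : grv) (t : R) : C :=
  grv_dist X (fun x => (Cexp (Ci * RtoC (t * x)) * grv_test X x)%C).

(* Weak characteristic function of the sum of the two components of [J]. *)
Definition weak_char_sum (J : grv2) (t : R) : C :=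
  grv2_dist J (fun x y => (Cexp (Ci * RtoC (t * (x + y))) * grv2_test J x y)%C).

(* [X] and [Y] are independent with joint representation [J]. *)
Definition independent (J : grv2) (X Y : grv) : Prop :=
  is_tensor (grv2_dist J) (grv_dist X) (grv_dist Y) /\
  forall x y : R, grv2_test J x y = (grv_test X x * grv_test Y y)%C.

(** * Weak cumulants *)

(* [K] is a continuous branch of log phi near 0. *)
Definition is_weak_cgf (phi K : R -> C) : Prop :=
  locally 0 (fun t : R =>
    @continuous R_UniformSpace C_UniformSpace K t /\ Cexp (K t) = phi t).

(* The n-th weak cumulant exists and equals [k]: there is a continuous branch,
   and every such branch is n times differentiable and gives the value [k]. *)
Definition is_weak_cumulant (phi : R -> C) (n : nat) (k : C) : Prop :=
  (exists K : R -> C, is_weak_cgf phi K) /\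
  (forall K : R -> C, is_weak_cgf phi K ->
     locally 0 (fun t : R => forall m : nat, (m <= n)%nat -> ex_Cderive_n K m t) /\
     k = (/ Cpow Ci n * Cderive_n K n 0)%C).

Definition ex_weak_cumulant (phi : R -> C) (n : nat) : Prop :=
  exists k : C, is_weak_cumulant phi n k.

(* Unspecified when the cumulant does not exist. *)
Definition weak_cumulant (phi : R -> C) (n : nat) : C :=
  epsilon (inhabits (RtoC 0)) (is_weak_cumulant phi n).

(* Main.v *)
(* For a Schwartz function f, the families e^{ihx} f, (e^{ihx} - 1) f and
   (e^{ihx} - 1 - ihx) f have Schwartz seminorms O(1), O(|h|) and O(h^2) as h -> 0: each
   differentiates in x into itself plus ih times the previous one.  By continuity of T,
   the map t |-> <T, e^{itx} f> therefore has derivative <T, e^{itx} (ix f)>, and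
   iterating makes it smooth.  A smooth function with nonzero value at 0 has a smooth
   logarithm near 0, and two continuous logarithms differ there by a constant, so
   cumulants of order at least 1 exist and can be computed from any branch.  Since
   phi_{X+Y} = phi_X phi_Y, the sum of a branch for X and one for Y is a branch for X + Y. *)

Require Import Defs.
From Stdlib Require Import Reals.
From Stdlib Require Import Lra Lia FunctionalExtensionality ClassicalEpsilon.
From Coquelicot Require Import Coquelicot.

(** * Rapidly decreasing families *)

Lemma Ceq (a b : C) : Re a = Re b -> Im a = Im b -> a = b.
Proof. destruct a, b; simpl; intros; subst; reflexivity. Qed.

Definition is_Cderive (f : R -> C) (x : R) (l : C) : Prop :=
  is_derive (fun t => Re (f t)) x (Re l) /\ is_derive (fun t => Im (f t)) x (Im l).

Lemma is_derive_eq (f : R -> R) (x l l' : R) : is_derive f x l -> l = l' -> is_derive f x l'.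
Proof. intros H <-; exact H. Qed.

Lemma is_derive_Rmult (f g : R -> R) (x a b : R) :
  is_derive f x a -> is_derive g x b ->
  is_derive (fun t => f t * g t) x (a * g x + f x * b).
Proof. intros Hf Hg; apply (is_derive_mult f g x a b Hf Hg); intros; apply Rmult_comm. Qed.

Lemma is_Cderive_eq (f : R -> C) (x : R) (l l' : C) :
  is_Cderive f x l -> l = l' -> is_Cderive f x l'.
Proof. intros H <-; exact H. Qed.

Lemma is_Cderive_plus (f g : R -> C) (x : R) (a b : C) :
  is_Cderive f x a -> is_Cderive g x b ->
  is_Cderive (fun t => (f t + g t)%C) x (a + b)%C.
Proof.
intros [Hf1 Hf2] [Hg1 Hg2]; split; simpl.
- exact (is_derive_plus _ _ _ _ _ Hf1 Hg1).
- exact (is_derive_plus _ _ _ _ _ Hf2 Hg2).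
Qed.

Lemma is_Cderive_mult (f g : R -> C) (x : R) (a b : C) :
  is_Cderive f x a -> is_Cderive g x b ->
  is_Cderive (fun t => (f t * g t)%C) x (a * g x + f x * b)%C.
Proof.
intros [Hf1 Hf2] [Hg1 Hg2]; split; simpl.
- eapply is_derive_eq.
  + apply (is_derive_minus (fun t => Re (f t) * Re (g t)) (fun t => Im (f t) * Im (g t)));
      apply is_derive_Rmult; eassumption.
  + unfold minus, plus, opp; simpl; unfold Re, Im; ring.
- eapply is_derive_eq.
  + apply (is_derive_plus (fun t => Re (f t) * Im (g t)) (fun t => Im (f t) * Re (g t)));
      apply is_derive_Rmult; eassumption.
  + unfold plus; simpl; unfold Re, Im; ring.
Qed.

Lemma is_Cderive_const (c : C) (x : R) : is_Cderive (fun _ => c) x (RtoC 0).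
Proof. split; exact (is_derive_const _ _). Qed.

Lemma is_Cderive_id (x : R) : is_Cderive RtoC x (RtoC 1).
Proof. split; [exact (is_derive_id _) | exact (is_derive_const _ _)]. Qed.

Lemma Cexp_Ci (y : R) : Cexp (Ci * RtoC y)%C = (cos y, sin y).
Proof.
unfold Cexp, Ci, RtoC, Cmult, Re, Im; simpl.
replace (0 * y - 1 * 0) with 0 by ring; replace (0 * 0 + 1 * y) with y by ring.
rewrite exp_0, !Rmult_1_l; reflexivity.
Qed.

Lemma Cexp_plus (a b : C) : Cexp (a + b) = (Cexp a * Cexp b)%C.
Proof.
unfold Cexp, Re, Im; simpl; rewrite exp_plus, cos_plus, sin_plus.
apply Ceq; simpl; ring.
Qed.

Lemma Cexp_Ci_plus (x y : R) :
  Cexp (Ci * RtoC (x + y)) = (Cexp (Ci * RtoC x) * Cexp (Ci * RtoC y))%C.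
Proof. rewrite RtoC_plus, Cmult_plus_distr_l; apply Cexp_plus. Qed.

Lemma is_Cderive_Cexp (h x : R) :
  is_Cderive (fun x => Cexp (Ci * RtoC (h * x))) x (Ci * RtoC h * Cexp (Ci * RtoC (h * x)))%C.
Proof.
rewrite Cexp_Ci; split.
- apply is_derive_ext with (fun x => cos (h * x)).
  + intros t; rewrite Cexp_Ci; reflexivity.
  + auto_derive; [trivial | simpl; ring].
- apply is_derive_ext with (fun x => sin (h * x)).
  + intros t; rewrite Cexp_Ci; reflexivity.
  + auto_derive; [trivial | simpl; ring].
Qed.

(* Every x-derivative of [F h] up to order [n] is rapidly decreasing, with bounds
   proportional to [w h], uniformly in |h| <= [B]. *)
Fixpoint decays (B : R) (w : R -> R) (n : nat) (F : R -> R -> C) : Prop :=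
  (forall k : nat, exists M : R, 0 <= M /\
     forall h x : R, Rabs h <= B -> Rabs x ^ k * Cmod (F h x) <= M * w h) /\
  match n with
  | O => True
  | S m => exists F' : R -> R -> C,
      (forall h x : R, Rabs h <= B -> is_Cderive (F h) x (F' h x)) /\ decays B w m F'
  end.

Lemma decays_bound B w n F : decays B w n F ->
  forall k : nat, exists M : R, 0 <= M /\
     forall h x : R, Rabs h <= B -> Rabs x ^ k * Cmod (F h x) <= M * w h.
Proof. destruct n; intros [H _]; exact H. Qed.

Lemma decays_ext B w n F G :
  (forall h x, F h x = G h x) -> decays B w n F -> decays B w n G.
Proof.
intros E; replace G with F; [trivial|].
apply functional_extensionality; intros h; apply functional_extensionality; intros x; apply E.
Qed.

Lemma decays_plus B w n : forall F G, decays B w n F -> decays B w n G ->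
  decays B w n (fun h x => (F h x + G h x)%C).
Proof.
induction n as [|n IH]; intros F G HF HG; (split; [intros k|]).
1,3: destruct (decays_bound _ _ _ _ HF k) as [M [HM H]];
  destruct (decays_bound _ _ _ _ HG k) as [M' [HM' H']];
  exists (M + M'); split; [lra|]; intros h x Hh;
  specialize (H h x Hh); specialize (H' h x Hh);
  assert (H1 := Cmod_triangle (F h x) (G h x));
  assert (H2 : 0 <= Rabs x ^ k) by (apply pow_le, Rabs_pos);
  apply (Rmult_le_compat_l _ _ _ H2) in H1; lra.
- exact I.
- destruct HF as [_ [F' [HF1 HF2]]], HG as [_ [G' [HG1 HG2]]].
  exists (fun h x => (F' h x + G' h x)%C); split.
  + intros h x Hh; apply is_Cderive_plus; auto.
  + auto.
Qed.

(** A factor independent of [x] commutes with differentiation in [x], so only the weights need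
    comparing. The factor [ih] turns weight 1 into [|h|] and [|h|] into [h^2]; the factor [1/h]
    turns [h^2] back into [|h|]. *)
Lemma decays_scale B w w' (c : R -> C) (A : R) n : 0 <= A ->
  (forall h, Rabs h <= B -> Cmod (c h) * w h <= A * w' h) ->
  forall F, decays B w n F -> decays B w' n (fun h x => (c h * F h x)%C).
Proof.
intros HA Hc; induction n as [|n IH]; intros F HF; (split; [intros k|]).
1,3: destruct (decays_bound _ _ _ _ HF k) as [M [HM H]];
  exists (M * A); split; [apply Rmult_le_pos; assumption|]; intros h x Hh;
  specialize (H h x Hh); specialize (Hc h Hh);
  rewrite Cmod_mult;
  apply (Rmult_le_compat_l _ _ _ (Cmod_ge_0 (c h))) in H;
  apply (Rmult_le_compat_l _ _ _ HM) in Hc; lra.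
- exact I.
- destruct HF as [_ [F' [HF1 HF2]]].
  exists (fun h x => (c h * F' h x)%C); split.
  + intros h x Hh; eapply is_Cderive_eq.
    * apply is_Cderive_mult; [apply is_Cderive_const | apply HF1, Hh].
    * cbv beta; ring.
  + auto.
Qed.

(** The factor [|x|] is absorbed by the bound for the power [k + 1]. The derivative is [F + x F'],
    whose first summand calls for decay of [F] at the lower order [n]. *)
Lemma decays_RtoC_mult B w n : forall F, decays B w n F ->
  decays B w n (fun h x => (RtoC x * F h x)%C).
Proof.
induction n as [|n IH]; intros F HF; (split; [intros k|]).
1,3: destruct (decays_bound _ _ _ _ HF (S k)) as [M [HM H]];
  exists M; split; [assumption|]; intros h x Hh; specialize (H h x Hh);
  rewrite Cmod_mult, Cmod_R; simpl in H; lra.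
- exact I.
- destruct HF as [HF0 [F' [HF1 HF2]]].
  (* Decay of order [n + 1] implies decay of order [n]: the last derivative of the chain is
     dropped. *)
  assert (HF : decays B w n F).
  { clear IH; revert F F' HF0 HF1 HF2.
    induction n as [|n IHn]; intros F F' HF0 HF1 HF2; split; auto.
    exists F'; split; auto.
    destruct HF2 as [HF2 [F'' [HF3 HF4]]]; eapply IHn; eauto. }
  exists (fun h x => (F h x + RtoC x * F' h x)%C); split.
  + intros h x Hh; eapply is_Cderive_eq.
    * apply is_Cderive_mult; [apply is_Cderive_id | apply HF1, Hh].
    * cbv beta; ring.
  + apply decays_plus; auto.
Qed.

(** * Seminorms of decaying families and closure properties of Schwartz functions *)

(** [Derive_n] applies the new derivative outermost, whereas [decays] peels off the innermost one;
    this reconciles the two orders. *)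
Lemma Cderive_n_succ (f f' : R -> C) (m : nat) (x : R) :
  (forall t, is_Cderive f t (f' t)) ->
  Cderive_n f (S m) x = Cderive_n f' m x /\
  (ex_Cderive_n f' m x -> ex_Cderive_n f (S m) x).
Proof.
intros H.
assert (G : forall g g' : R -> R, (forall t, is_derive g t (g' t)) ->
  Derive_n g (S m) x = Derive_n g' m x /\ (ex_derive_n g' m x -> ex_derive_n g (S m) x)).
{ intros g g' Hg.
  assert (E : forall j, Derive_n g (S j) = Derive_n g' j).
  { intros j; apply functional_extensionality; intros t.
    replace (S j) with (j + 1)%nat by lia; rewrite <- Derive_n_comp.
    apply Derive_n_ext; intros s; apply is_derive_unique, Hg. }
  split; [rewrite E; reflexivity|].
  destruct m as [|m].
  - intros _; exists (g' x); apply Hg.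
  - intros H1; change (ex_derive (Derive_n g (S m)) x); rewrite E; exact H1. }
destruct (G (fun t => Re (f t)) (fun t => Re (f' t))) as [G1 G2]; [apply H|].
destruct (G (fun t => Im (f t)) (fun t => Im (f' t))) as [G3 G4]; [apply H|].
split.
- unfold Cderive_n; rewrite G1, G3; reflexivity.
- intros [H1 H2]; split; auto.
Qed.

(** Translates the chain of derivatives hidden in [decays] into Schwartz seminorms, keeping the
    constant [M] uniform in [h]. *)
Lemma decays_seminorm B w m : forall n F, (m <= n)%nat -> decays B w n F ->
  (forall h x, Rabs h <= B -> ex_Cderive_n (F h) m x) /\
  forall k, exists M, 0 <= M /\ forall h, Rabs h <= B -> seminorm_le k m (F h) (M * w h).
Proof.
induction m as [|m IH]; intros n F Hn HF.
- split; [intros; split; exact I|]; intros k.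
  destruct (decays_bound _ _ _ _ HF k) as [M [HM H]]; exists M; split; auto.
  intros h Hh x; specialize (H h x Hh); unfold Cderive_n; simpl.
  unfold Re, Im; rewrite <- surjective_pairing; exact H.
- destruct n as [|n]; [lia|].
  destruct HF as [_ [F' [HF1 HF2]]].
  destruct (IH n F') as [H1 H2]; [lia | assumption |]; split.
  + intros h x Hh; apply (Cderive_n_succ (F h) (F' h)); auto.
  + intros k; destruct (H2 k) as [M [HM H]]; exists M; split; auto.
    intros h Hh x; destruct (Cderive_n_succ (F h) (F' h) m x) as [E _]; auto.
    rewrite E; apply H, Hh.
Qed.

Lemma decays_schwartz B w F h : Rabs h <= B -> (forall n, decays B w n F) -> schwartz (F h).
Proof.
intros Hh H; split.
- intros n x; apply (decays_seminorm B w n n F); auto.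
- intros k n; destruct (decays_seminorm B w n n F) as [_ H1]; auto.
  destruct (H1 k) as [M [_ HM]]; exists (M * w h); auto.
Qed.

Lemma decays_const B n (f : R -> C) : schwartz f -> decays B (fun _ => 1) n (fun _ x => f x).
Proof.
intros [H1 H2].
(* The induction passes from one derivative of [f] to the next, so all of them are treated
   together. *)
assert (G : forall m, decays B (fun _ => 1) n (fun _ x => Cderive_n f m x)).
{ induction n as [|n IH]; intros m; (split; [intros k|]).
  1,3: destruct (H2 k m) as [M HM]; exists (Rmax 0 M); split; [apply Rmax_l|];
    intros h x _; specialize (HM x); assert (HM' := Rmax_r 0 M); lra.
  - exact I.
  - exists (fun _ x => Cderive_n f (S m) x); split; [|apply IH].
    intros _ x _; destruct (H1 (S m) x) as [Ha Hb].
    split; apply Derive_correct; assumption. }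
apply decays_ext with (2 := G O).
intros _ x; unfold Cderive_n, Re, Im; simpl; rewrite <- surjective_pairing; reflexivity.
Qed.

(** Closure of Schwartz functions is read off from closure of families that do not depend on the
    parameter; [B = 0] and [h = 0] are arbitrary choices. *)
Lemma schwartz_lin (a b : C) (f g : R -> C) :
  schwartz f -> schwartz g -> schwartz (fun x => (a * f x + b * g x)%C).
Proof.
intros Hf Hg.
apply (decays_schwartz 0 (fun _ => 1) (fun _ x => (a * f x + b * g x)%C) 0).
- rewrite Rabs_R0; lra.
- intros n; apply decays_plus;
  [apply (decays_scale 0 (fun _ => 1) _ (fun _ => a) (Cmod a))
  |apply (decays_scale 0 (fun _ => 1) _ (fun _ => b) (Cmod b))];
  try apply Cmod_ge_0; try (intros; lra); apply decays_const; assumption.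
Qed.

Lemma schwartz_scale (a : C) (f : R -> C) : schwartz f -> schwartz (fun x => (a * f x)%C).
Proof.
intros Hf; replace (fun x => (a * f x)%C) with (fun x => (a * f x + 0 * f x)%C).
- apply schwartz_lin; assumption.
- apply functional_extensionality; intros x; ring.
Qed.

Lemma schwartz_RtoC_mult (f : R -> C) : schwartz f -> schwartz (fun x => (RtoC x * f x)%C).
Proof.
intros Hf.
apply (decays_schwartz 0 (fun _ => 1) (fun _ x => (RtoC x * f x)%C) 0).
- rewrite Rabs_R0; lra.
- intros n; apply (decays_RtoC_mult _ _ _ (fun _ x => f x)), decays_const, Hf.
Qed.

Lemma schwartz_derive (f : R -> C) : schwartz f ->
  exists f', schwartz f' /\ forall x, is_Cderive f x (f' x).
Proof.
intros [H1 H2]; exists (fun x => Cderive_n f 1 x).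
assert (D : forall x, is_Cderive f x (Cderive_n f 1 x)).
{ intros x; destruct (H1 1%nat x); split; apply Derive_correct; assumption. }
split; [|exact D].
assert (E : forall g : R -> R, forall j x,
  Derive_n (fun y => Derive_n g 1 y) j x = Derive_n g (S j) x).
{ intros g j x; rewrite Derive_n_comp; f_equal; lia. }
assert (E' : forall g : R -> R, forall j x,
  ex_derive_n g (S j) x -> ex_derive_n (fun y => Derive_n g 1 y) j x).
{ intros g j x Hx; destruct j as [|j]; [exact I|].
  apply ex_derive_ext with (2 := Hx); intros t; rewrite E; reflexivity. }
split.
- intros n x; destruct (H1 (S n) x) as [Ha Hb].
  split; [apply (E' (fun t => Re (f t)))|apply (E' (fun t => Im (f t)))]; assumption.
- intros k n; destruct (H2 k (S n)) as [M HM]; exists M; intros x; specialize (HM x).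
  replace (Cderive_n (fun x => Cderive_n f 1 x) n x) with (Cderive_n f (S n) x); [exact HM|].
  unfold Cderive_n; f_equal;
  [rewrite <- (E (fun t => Re (f t)))|rewrite <- (E (fun t => Im (f t)))]; reflexivity.
Qed.

(** * Elementary bounds for sine, cosine and [e^{iy}] *)

Lemma sin_abs_le (y : R) : Rabs (sin y) <= Rabs y.
Proof.
assert (P : forall z, 0 < z -> Rabs (sin z) <= z).
{ intros z Hz; apply Rabs_le; split.
  - destruct (Rle_dec z 1).
    + assert (0 <= sin z); [|lra].
      assert (H := PI2_1); apply sin_ge_0; lra.
    + destruct (SIN_bound z); lra.
  - left; apply sin_lt_x, Hz. }
destruct (Rtotal_order y 0) as [H|[->|H]].
- rewrite <- (Rabs_Ropp (sin y)), <- sin_neg, (Rabs_left y H); apply P; lra.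
- rewrite sin_0; lra.
- rewrite (Rabs_right y); [apply P, H | lra].
Qed.

Lemma cos_sub1_abs_le (y : R) : Rabs (cos y - 1) <= y ^ 2 / 2.
Proof.
replace (cos y) with (cos (2 * (y / 2))) by (f_equal; field).
rewrite cos_2a_sin.
assert (H := sin_abs_le (y / 2)).
apply Rsqr_le_abs_1 in H; unfold Rsqr in H.
rewrite Rabs_left1; nra.
Qed.

(** In [1 - cos y = 2 sin^2(y/2)] one sine is bounded by 1 and the other by [|y|/2]. *)
Lemma cos_sub1_abs_le1 (y : R) : Rabs (cos y - 1) <= Rabs y.
Proof.
replace (cos y) with (cos (2 * (y / 2))) by (f_equal; field).
rewrite cos_2a_sin.
assert (H := sin_abs_le (y / 2)).
destruct (SIN_bound (y / 2)) as [H1 H2].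
replace (Rabs y) with (2 * Rabs (y / 2)).
2: { replace y with (2 * (y / 2)) at 2 by field.
     rewrite Rabs_mult, (Rabs_right 2); lra. }
replace (1 - 2 * sin (y / 2) * sin (y / 2) - 1) with (- (2 * (sin (y / 2) * sin (y / 2)))) by ring.
rewrite Rabs_Ropp, Rabs_mult, (Rabs_right 2), Rabs_mult by lra.
assert (Rabs (sin (y / 2)) <= 1) by (apply Rabs_le; lra).
assert (0 <= Rabs (sin (y / 2))) by apply Rabs_pos.
nra.
Qed.

(** By the mean value theorem [sin y - y = (cos c - 1) y] with [c] between 0 and [y], and
    [|cos c - 1| <= |c| <= |y|]. *)
Lemma sin_sub_id_abs_le (y : R) : Rabs (sin y - y) <= y ^ 2.
Proof.
destruct (MVT_gen (fun z => sin z - z) 0 y (fun z => cos z - 1)) as [c [Hc1 Hc2]].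
- intros; auto_derive; [trivial|ring].
- intros; apply continuity_pt_minus; [apply continuity_sin | apply continuity_pt_id].
- rewrite sin_0 in Hc2.
  replace (sin y - y) with ((cos c - 1) * y) by lra.
  rewrite Rabs_mult, <- pow2_abs; simpl; rewrite Rmult_1_r.
  apply Rmult_le_compat_r; [apply Rabs_pos|].
  eapply Rle_trans; [apply cos_sub1_abs_le1|].
  revert Hc1; unfold Rmin, Rmax, Rabs; repeat destruct Rle_dec; repeat destruct Rcase_abs; lra.
Qed.

Lemma Cmod_le_abs (z : C) : Cmod z <= Rabs (Re z) + Rabs (Im z).
Proof.
unfold Cmod; apply Rsqr_incr_0_var.
- rewrite Rsqr_sqrt by (apply Rplus_le_le_0_compat; apply pow2_ge_0).
  unfold Rsqr, Re, Im; rewrite <- (pow2_abs (fst z)), <- (pow2_abs (snd z)).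
  assert (H1 := Rabs_pos (fst z)); assert (H2 := Rabs_pos (snd z)); nra.
- assert (H1 := Rabs_pos (Re z)); assert (H2 := Rabs_pos (Im z)); lra.
Qed.

Lemma Rabs_Re_le_Cmod (z : C) : Rabs (Re z) <= Cmod z.
Proof. exact (Rle_trans _ _ _ (Rmax_l _ _) (Rmax_Cmod z)). Qed.

Lemma Rabs_Im_le_Cmod (z : C) : Rabs (Im z) <= Cmod z.
Proof. exact (Rle_trans _ _ _ (Rmax_r _ _) (Rmax_Cmod z)). Qed.

Lemma Cmod_Cexp_Ci (y : R) : Cmod (Cexp (Ci * RtoC y)) = 1.
Proof.
rewrite Cexp_Ci; unfold Cmod; simpl.
transitivity (sqrt 1); [f_equal | exact sqrt_1].
assert (H := sin2_cos2 y); unfold Rsqr in H; lra.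
Qed.

Lemma Cmod_Cexp_Ci_sub1 (y : R) : Cmod (Cexp (Ci * RtoC y) - 1) <= 2 * Rabs y.
Proof.
rewrite Cexp_Ci; eapply Rle_trans; [apply Cmod_le_abs|]; simpl.
assert (H1 := sin_abs_le y); assert (H2 := cos_sub1_abs_le1 y).
unfold Rminus in H2; rewrite Ropp_0, Rplus_0_r; lra.
Qed.

Lemma Cmod_Cexp_Ci_sub2 (y : R) :
  Cmod (Cexp (Ci * RtoC y) - 1 - Ci * RtoC y) <= 2 * y ^ 2.
Proof.
rewrite Cexp_Ci; eapply Rle_trans; [apply Cmod_le_abs|]; simpl.
assert (H1 := sin_sub_id_abs_le y); assert (H2 := cos_sub1_abs_le y).
replace (cos y + - (1) + - (0 * y - 1 * 0)) with (cos y - 1) by ring.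
replace (sin y + - 0 + - (0 * 0 + 1 * y)) with (sin y - y) by ring.
nra.
Qed.

(** * Decay of the exponential families *)

(** The exponential has modulus 1, and the derivative is [ih] times the same family plus the family
    of [f']. The bound [|ih| <= B] keeps the weight constant. *)
Lemma decays_Cexp B n : 0 <= B -> forall f, schwartz f ->
  decays B (fun _ => 1) n (fun h x => (Cexp (Ci * RtoC (h * x)) * f x)%C).
Proof.
intros HB; induction n as [|n IH]; intros f Hf; (split; [intros k|]).
1,3: destruct (decays_bound _ _ _ _ (decays_const B O f Hf) k) as [M [HM H]];
  exists M; split; [assumption|]; intros h x Hh;
  rewrite Cmod_mult, Cmod_Cexp_Ci, Rmult_1_l; exact (H h x Hh).
- exact I.
- destruct (schwartz_derive f Hf) as [f' [Hf' D]].
  exists (fun h x => ((Ci * RtoC h) * (Cexp (Ci * RtoC (h * x)) * f x)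
                     + Cexp (Ci * RtoC (h * x)) * f' x)%C); split.
  + intros h x Hh; eapply is_Cderive_eq.
    * apply is_Cderive_mult; [apply is_Cderive_Cexp | apply D].
    * cbv beta; ring.
  + apply decays_plus; [|apply IH, Hf'].
    apply (decays_scale B (fun _ => 1) _ (fun h => Ci * RtoC h)%C B n HB).
    * intros h Hh; rewrite Cmod_mult, Cmod_R, Cmod_Ci; lra.
    * apply IH, Hf.
Qed.

(** Since [|e^{ihx} - 1| <= 2|h||x|], the extra [|x|] is paid for by the power [k + 1] of [f]. In
    the derivative the factor [ih] supplies the weight [|h|]. *)
Lemma decays_Cexp_sub1 B n : 0 <= B -> forall f, schwartz f ->
  decays B Rabs n (fun h x => ((Cexp (Ci * RtoC (h * x)) - 1) * f x)%C).
Proof.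
intros HB; induction n as [|n IH]; intros f Hf; (split; [intros k|]).
1,3: destruct (decays_bound _ _ _ _ (decays_const B O f Hf) (S k)) as [M [HM H]];
  exists (2 * M); split; [lra|]; intros h x Hh;
  specialize (H h x Hh); simpl in H;
  assert (H1 := Cmod_Cexp_Ci_sub1 (h * x)); rewrite Rabs_mult in H1;
  rewrite Cmod_mult;
  assert (H2 : 0 <= Rabs x ^ k * Cmod (f x))
    by (apply Rmult_le_pos; [apply pow_le, Rabs_pos | apply Cmod_ge_0]);
  apply (Rmult_le_compat_l _ _ _ H2) in H1;
  apply (Rmult_le_compat_l _ _ _ (Rabs_pos h)) in H; lra.
- exact I.
- destruct (schwartz_derive f Hf) as [f' [Hf' D]].
  exists (fun h x => ((Ci * RtoC h) * (Cexp (Ci * RtoC (h * x)) * f x)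
                     + (Cexp (Ci * RtoC (h * x)) - 1) * f' x)%C); split.
  + intros h x Hh; eapply is_Cderive_eq.
    * apply is_Cderive_mult; [|apply D].
      apply is_Cderive_plus; [apply is_Cderive_Cexp | apply is_Cderive_const].
    * cbv beta; ring.
  + apply decays_plus; [|apply IH, Hf'].
    apply (decays_scale B (fun _ => 1) _ (fun h => Ci * RtoC h)%C 1 n Rle_0_1).
    * intros h Hh; rewrite Cmod_mult, Cmod_R, Cmod_Ci; lra.
    * apply decays_Cexp; assumption.
Qed.

(** The second-order remainder is at most [2 h^2 x^2], so the power [k + 2] of [f] is used. In the
    derivative, [ih] times a family of weight [|h|] has weight [h^2]. *)
Lemma decays_Cexp_sub2 B n : 0 <= B -> forall f, schwartz f ->
  decays B (fun h => h ^ 2) n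
    (fun h x => ((Cexp (Ci * RtoC (h * x)) - 1 - Ci * RtoC (h * x)) * f x)%C).
Proof.
intros HB; induction n as [|n IH]; intros f Hf; (split; [intros k|]).
1,3: destruct (decays_bound _ _ _ _ (decays_const B O f Hf) (S (S k))) as [M [HM H]];
  exists (2 * M); split; [lra|]; intros h x Hh;
  specialize (H h x Hh); simpl in H;
  assert (H1 := Cmod_Cexp_Ci_sub2 (h * x)); rewrite Cmod_mult;
  assert (H2 : 0 <= Rabs x ^ k * Cmod (f x))
    by (apply Rmult_le_pos; [apply pow_le, Rabs_pos | apply Cmod_ge_0]);
  apply (Rmult_le_compat_l _ _ _ H2) in H1;
  assert (H3 := pow2_abs x); simpl in H3;
  replace (Rabs x * (Rabs x * Rabs x ^ k)) with ((x * x) * Rabs x ^ k) in H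
    by (rewrite Rmult_1_r in H3; rewrite <- Rmult_assoc; f_equal; lra);
  apply (Rmult_le_compat_l _ _ _ (pow2_ge_0 h)) in H; nra.
- exact I.
- destruct (schwartz_derive f Hf) as [f' [Hf' D]].
  exists (fun h x => ((Ci * RtoC h) * ((Cexp (Ci * RtoC (h * x)) - 1) * f x)
             + (Cexp (Ci * RtoC (h * x)) - 1 - Ci * RtoC (h * x)) * f' x)%C); split.
  + intros h x Hh.
    replace (fun x => ((Cexp (Ci * RtoC (h * x)) - 1 - Ci * RtoC (h * x)) * f x)%C)
      with (fun x => ((Cexp (Ci * RtoC (h * x)) + - RtoC 1 + - (Ci * RtoC h) * RtoC x) * f x)%C).
    2: { apply functional_extensionality; intros y; rewrite RtoC_mult; ring. }
    eapply is_Cderive_eq.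
    * apply is_Cderive_mult; [|apply D].
      apply is_Cderive_plus; [apply is_Cderive_plus |].
      -- apply is_Cderive_Cexp.
      -- apply is_Cderive_const.
      -- apply is_Cderive_mult; [apply is_Cderive_const | apply is_Cderive_id].
    * cbv beta; rewrite !RtoC_mult; ring.
  + apply decays_plus; [|apply IH, Hf'].
    apply (decays_scale B Rabs _ (fun h => Ci * RtoC h)%C 1 n Rle_0_1).
    * intros h Hh; rewrite Cmod_mult, Cmod_R, Cmod_Ci, <- (pow2_abs h); simpl; lra.
    * apply decays_Cexp_sub1; assumption.
Qed.

Lemma schwartz_Cexp (t : R) (f : R -> C) :
  schwartz f -> schwartz (fun x => (Cexp (Ci * RtoC (t * x)) * f x)%C).
Proof.
intros Hf.
apply (decays_schwartz (Rabs t) (fun _ => 1) (fun h x => (Cexp (Ci * RtoC (h * x)) * f x)%C) t).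
- lra.
- intros n; apply decays_Cexp; [apply Rabs_pos | exact Hf].
Qed.

(** * Smoothness of the weak characteristic function *)

Lemma tempered_scale T (a : C) f : tempered T -> schwartz f ->
  T (fun x => (a * f x)%C) = (a * T f)%C.
Proof.
intros [H _] Hf.
replace (fun x => (a * f x)%C) with (fun x => (a * f x + 0 * f x)%C).
- rewrite H by assumption; ring.
- apply functional_extensionality; intros x; ring.
Qed.

(** Continuity of a tempered distribution involves all seminorms up to some order [N] together. The
    finitely many separate constants are merged by adding them up, first over [n], then over [k]. *)
Lemma finite_bound (P : nat -> nat -> R -> Prop) :
  (forall k n M M', M <= M' -> P k n M -> P k n M') ->
  (forall k n, exists M, 0 <= M /\ P k n M) ->
  forall N, exists M, 0 <= M /\ forall k n, (k <= N)%nat -> (n <= N)%nat -> P k n M.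
Proof.
intros Hmon H N.
assert (G1 : forall k N, exists M, 0 <= M /\ forall n, (n <= N)%nat -> P k n M).
{ intros k N'; induction N' as [|m [M [HM IH]]].
  - destruct (H k O) as [M [HM HP]]; exists M; split; auto.
    intros n Hn; replace n with O by lia; exact HP.
  - destruct (H k (S m)) as [M' [HM' HP]]; exists (M + M'); split; [lra|].
    intros n Hn; destruct (Nat.eq_dec n (S m)) as [->|].
    + apply Hmon with M'; auto; lra.
    + apply Hmon with M; [lra|]; apply IH; lia. }
assert (G2 : forall K, exists M, 0 <= M /\
  forall k n, (k <= K)%nat -> (n <= N)%nat -> P k n M).
{ intros K; induction K as [|m [M [HM IH]]].
  - destruct (G1 O N) as [M [HM HP]]; exists M; split; auto.
    intros k n Hk; replace k with O by lia; apply HP.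
  - destruct (G1 (S m) N) as [M' [HM' HP]]; exists (M + M'); split; [lra|].
    intros k n Hk Hn; destruct (Nat.eq_dec k (S m)) as [->|].
    + apply Hmon with M'; auto; lra.
    + apply Hmon with M; [lra|]; apply IH; lia. }
apply G2.
Qed.

(** Continuity of [T] at the zero function: all seminorms of [F h] are [O(|h|)], hence eventually
    below the required [delta]. *)
Lemma tempered_small T (F : R -> R -> C) : tempered T ->
  (forall n, decays 1 Rabs n F) ->
  forall eps, 0 < eps -> exists d, 0 < d /\ forall h, Rabs h < d -> Cmod (T (F h)) < eps.
Proof.
intros HT HF eps Heps.
(* The zero function is written as a multiple of [F 0], so that linearity gives the value of [T] on
   it. *)
assert (Z : schwartz (fun x => (0 * F 0 x)%C)).
{ apply schwartz_scale, (decays_schwartz 1 Rabs); [rewrite Rabs_R0; lra | exact HF]. }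
destruct (proj2 HT _ Z eps Heps) as [N [delta [Hd HN]]].
destruct (finite_bound
  (fun k n M => forall h, Rabs h <= 1 -> seminorm_le k n (F h) (M * Rabs h))) with N
  as [M [HM HMN]].
- intros k n M M' HMM HP h Hh x.
  eapply Rle_trans; [apply HP, Hh|]; apply Rmult_le_compat_r; [apply Rabs_pos | exact HMM].
- intros k n; apply (proj2 (decays_seminorm 1 Rabs n n F (le_n n) (HF n)) k).
(* The bound 1 keeps [h] in the range of the decay estimates; [M + 1] is positive even when
   [M = 0]. *)
- exists (Rmin 1 (delta / (M + 1))); split.
  + apply Rmin_glb_lt; [lra|]; apply Rdiv_lt_0_compat; lra.
  + intros h Hh.
    assert (Hh1 : Rabs h <= 1) by (assert (H := Rmin_l 1 (delta / (M + 1))); lra).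
    assert (Hh2 : (M + 1) * Rabs h <= delta).
    { assert (H := Rmin_r 1 (delta / (M + 1))).
      replace delta with ((M + 1) * (delta / (M + 1))) by (field; lra).
      apply Rmult_le_compat_l; lra. }
    assert (SF : schwartz (F h)) by (apply (decays_schwartz 1 Rabs); assumption).
    specialize (HN (F h) SF).
    rewrite tempered_scale in HN; [|exact HT|].
    2: { apply (decays_schwartz 1 Rabs); [rewrite Rabs_R0; lra | exact HF]. }
    replace (T (F h) - 0 * T (F 0))%C with (T (F h)) in HN by ring.
    apply HN; intros k n Hk Hn.
    replace (fun x => (F h x - 0 * F 0 x)%C) with (F h).
    2: { apply functional_extensionality; intros x; ring. }
    intros x; eapply Rle_trans; [apply (HMN k n Hk Hn h Hh1)|].
    assert (0 <= Rabs h) by apply Rabs_pos; lra.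
Qed.

(** By linearity, the difference quotient minus the claimed derivative is [T (Q h)], where [Q h] is
    [(e^{ihx} - 1 - ihx)/h] times [e^{itx} f]. Its seminorms are [O(|h|)], so the error tends to
    0. *)
Lemma is_Cderive_weak_char T (f : R -> C) (t : R) : tempered T -> schwartz f ->
  is_Cderive (fun t => T (fun x => (Cexp (Ci * RtoC (t * x)) * f x)%C)) t
    (T (fun x => (Cexp (Ci * RtoC (t * x)) * (Ci * (RtoC x * f x)))%C)).
Proof.
intros HT Hf.
set (g := fun x => (Cexp (Ci * RtoC (t * x)) * f x)%C).
assert (Hg : schwartz g) by apply schwartz_Cexp, Hf.
set (Q := fun h x => (/ RtoC h * ((Cexp (Ci * RtoC (h * x)) - 1 - Ci * RtoC (h * x)) * g x))%C).
assert (HQ : forall n, decays 1 Rabs n Q).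
{ intros n; apply (decays_scale 1 (fun h => h ^ 2) _ (fun h => / RtoC h)%C 1 n Rle_0_1).
  (* At [h = 0] the weight [h^2] vanishes, which makes the estimate hold whatever value the inverse
     of 0 takes. *)
  - intros h _; destruct (Req_dec h 0) as [->|Hh].
    + rewrite Rabs_R0; simpl; lra.
    + rewrite Cmod_inv, Cmod_R by (intros H; apply Hh, RtoC_inj, H).
      rewrite <- pow2_abs; right; field; apply Rabs_no_R0, Hh.
  - apply decays_Cexp_sub2; [lra | exact Hg]. }
set (l := T (fun x => (Cexp (Ci * RtoC (t * x)) * (Ci * (RtoC x * f x)))%C)).
assert (E : forall h, h <> 0 -> T (Q h) =
  (/ RtoC h * (T (fun x => (Cexp (Ci * RtoC ((t + h) * x)) * f x)%C) - T g) - l)%C).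
{ intros h Hh.
  assert (Hh' : RtoC h <> RtoC 0) by (intros H; apply Hh, RtoC_inj, H).
  assert (El : l = (Ci * T (fun x => (RtoC x * g x)%C))%C).
  { rewrite <- tempered_scale; [|exact HT|apply schwartz_RtoC_mult, Hg].
    unfold l; f_equal; apply functional_extensionality; intros x; unfold g; ring. }
  rewrite El.
  (* [Q h] is regrouped as nested two-term combinations of Schwartz functions, the shape to which
     linearity of [T] applies. *)
  transitivity (T (fun x => (1 * (/ RtoC h * (Cexp (Ci * RtoC ((t + h) * x)) * f x)
     + - / RtoC h * g x) + - Ci * (RtoC x * g x))%C)).
  - f_equal; apply functional_extensionality; intros x; unfold Q, g.
    replace ((t + h) * x) with (t * x + h * x) by ring.
    rewrite Cexp_Ci_plus, (RtoC_mult h x).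
    field; exact Hh'.
  - assert (S1 := schwartz_Cexp (t + h) f Hf).
    assert (S2 := schwartz_RtoC_mult g Hg).
    assert (S3 := schwartz_lin (/ RtoC h) (- / RtoC h) _ g S1 Hg).
    rewrite (proj1 HT 1%C (- Ci)%C _ _ S3 S2), (proj1 HT _ _ _ _ S1 Hg); ring. }
assert (L := tempered_small T Q HT HQ).
split; apply is_derive_Reals; intros eps Heps; destruct (L eps Heps) as [d [Hd HL]];
  exists (mkposreal d Hd); intros h Hh Hhd; specialize (HL h Hhd); rewrite E in HL by exact Hh.
- eapply Rle_lt_trans; [|exact HL].
  eapply Rle_trans; [|apply Rabs_Re_le_Cmod].
  right; f_equal; rewrite <- RtoC_inv by exact Hh.
  fold l; fold g; generalize l (T g) (T (fun x => (Cexp (Ci * RtoC ((t + h) * x)) * f x)%C)).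
  intros u v w; simpl; unfold Re; field; exact Hh.
- eapply Rle_lt_trans; [|exact HL].
  eapply Rle_trans; [|apply Rabs_Im_le_Cmod].
  right; f_equal; rewrite <- RtoC_inv by exact Hh.
  fold l; fold g; generalize l (T g) (T (fun x => (Cexp (Ci * RtoC ((t + h) * x)) * f x)%C)).
  intros u v w; simpl; unfold Im; field; exact Hh.
Qed.

(** * Repeated differentiability on a set *)

(** A chain of explicit derivatives, rather than a condition on [Derive_n]: the rules for products,
    inverses and compositions then follow by short inductions. *)
Fixpoint differentiable_on (U : R -> Prop) (n : nat) (f : R -> R) : Prop :=
  match n with
  | O => True
  | S m => exists f' : R -> R,
      (forall t, U t -> is_derive f t (f' t)) /\ differentiable_on U m f'
  end.

Lemma differentiable_on_pred U n : forall f,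
  differentiable_on U (S n) f -> differentiable_on U n f.
Proof.
induction n as [|n IH]; intros f [f' [H1 H2]]; [exact I|].
exists f'; auto.
Qed.

Lemma differentiable_on_subset (U V : R -> Prop) n : (forall t, V t -> U t) ->
  forall f, differentiable_on U n f -> differentiable_on V n f.
Proof.
intros HUV; induction n as [|n IH]; intros f; [trivial|].
intros [f' [H1 H2]]; exists f'; auto.
Qed.

Lemma differentiable_on_const U n : forall c, differentiable_on U n (fun _ => c).
Proof.
induction n as [|n IH]; intros c; [exact I|].
exists (fun _ => 0); split; [intros; exact (is_derive_const _ _) | apply IH].
Qed.

Lemma differentiable_on_plus U n : forall f g,
  differentiable_on U n f -> differentiable_on U n g ->
  differentiable_on U n (fun t => f t + g t).
Proof.
induction n as [|n IH]; intros f g; [trivial|].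
intros [f' [Hf1 Hf2]] [g' [Hg1 Hg2]]; exists (fun t => f' t + g' t); split; auto.
intros t Ht; exact (is_derive_plus _ _ _ _ _ (Hf1 t Ht) (Hg1 t Ht)).
Qed.

Lemma differentiable_on_mult U n : forall f g,
  differentiable_on U n f -> differentiable_on U n g ->
  differentiable_on U n (fun t => f t * g t).
Proof.
induction n as [|n IH]; intros f g Hf Hg; [trivial|].
assert (Hf0 := differentiable_on_pred _ _ _ Hf).
assert (Hg0 := differentiable_on_pred _ _ _ Hg).
destruct Hf as [f' [Hf1 Hf2]], Hg as [g' [Hg1 Hg2]].
exists (fun t => f' t * g t + f t * g' t); split.
- intros t Ht; apply is_derive_Rmult; auto.
- apply differentiable_on_plus; auto.
Qed.

Lemma differentiable_on_minus U n f g :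
  differentiable_on U n f -> differentiable_on U n g ->
  differentiable_on U n (fun t => f t - g t).
Proof.
intros Hf Hg.
replace (fun t => f t - g t) with (fun t => f t + (-1) * g t).
- apply differentiable_on_plus; [exact Hf|].
  apply (differentiable_on_mult U n (fun _ => -1)); [apply differentiable_on_const | exact Hg].
- apply functional_extensionality; intros t; ring.
Qed.

(** The derivative [-g' (1/g)^2] contains [1/g] only to one order less, where the induction
    hypothesis applies. *)
Lemma differentiable_on_inv U n : forall g, (forall t, U t -> g t <> 0) ->
  differentiable_on U n g -> differentiable_on U n (fun t => / g t).
Proof.
induction n as [|n IH]; intros g Hnz Hg; [trivial|].
assert (Hg0 := differentiable_on_pred _ _ _ Hg).
destruct Hg as [g' [Hg1 Hg2]].
exists (fun t => (-1) * g' t * (/ g t * / g t)); split.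
- intros t Ht; eapply is_derive_eq; [apply is_derive_inv; auto|].
  field; auto.
- apply differentiable_on_mult; apply differentiable_on_mult; auto using differentiable_on_const.
Qed.

Lemma differentiable_on_ln U n g : (forall t, U t -> 0 < g t) ->
  differentiable_on U n g -> differentiable_on U n (fun t => ln (g t)).
Proof.
destruct n as [|n]; intros Hp Hg; [trivial|].
assert (Hg0 := differentiable_on_pred _ _ _ Hg).
destruct Hg as [g' [Hg1 Hg2]].
exists (fun t => g' t * / g t); split.
- intros t Ht; apply (is_derive_comp ln g t (/ g t) (g' t)); auto using is_derive_ln.
- apply differentiable_on_mult; [assumption|].
  apply differentiable_on_inv; [|assumption].
  intros t Ht; apply Rgt_not_eq, Hp, Ht.
Qed.

Lemma differentiable_on_atan U n g :
  differentiable_on U n g -> differentiable_on U n (fun t => atan (g t)).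
Proof.
destruct n as [|n]; intros Hg; [trivial|].
assert (Hg0 := differentiable_on_pred _ _ _ Hg).
destruct Hg as [g' [Hg1 Hg2]].
exists (fun t => g' t * / (1 + g t * g t)); split.
- intros t Ht; apply (is_derive_comp atan g t (/ (1 + g t * g t)) (g' t)); auto.
  exact (is_derive_atan (g t)).
- apply differentiable_on_mult; [assumption|].
  apply differentiable_on_inv; [intros t Ht; nra|].
  apply differentiable_on_plus; [apply differentiable_on_const|].
  apply differentiable_on_mult; assumption.
Qed.

(** Openness of [U] makes [Derive f] agree with [f'] on a whole neighbourhood of [t], so its higher
    derivatives at [t] can be taken from [f']. *)
Lemma differentiable_on_ex_derive_n (U : R -> Prop) n : open U ->
  forall f, differentiable_on U n f -> forall t, U t -> ex_derive_n f n t.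
Proof.
intros HU; induction n as [|n IH]; intros f; [intros; exact I|].
intros [f' [Hf1 Hf2]] t Ht.
destruct n as [|n]; [exists (f' t); auto|].
assert (H : ex_derive_n (Derive f) (S n) t).
{ apply ex_derive_n_ext_loc with f'; [|apply IH; auto].
  apply (locally_open U); auto.
  intros s Hs; symmetry; apply is_derive_unique; auto. }
apply ex_derive_ext with (2 := H); intros s.
change (Derive_n (Derive_n f 1) n s = Derive_n f (S n) s).
rewrite Derive_n_comp; f_equal; lia.
Qed.

Definition Csmooth_on (U : R -> Prop) (f : R -> C) : Prop :=
  forall n, differentiable_on U n (fun t => Re (f t)) /\ differentiable_on U n (fun t => Im (f t)).

Lemma Csmooth_on_mult U f g :
  Csmooth_on U f -> Csmooth_on U g -> Csmooth_on U (fun t => (f t * g t)%C).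
Proof.
intros Hf Hg n; destruct (Hf n), (Hg n); split;
  [apply differentiable_on_minus | apply differentiable_on_plus];
  apply differentiable_on_mult; assumption.
Qed.

Lemma Csmooth_on_const U c : Csmooth_on U (fun _ => c).
Proof. intros n; split; apply differentiable_on_const. Qed.

(** The derivative has the same form with the Schwartz function [ix f] in place of [f], so the
    induction on the order runs over all [f]. *)
Lemma Csmooth_weak_char T (f : R -> C) : tempered T -> schwartz f ->
  Csmooth_on (fun _ => True) (fun t => T (fun x => (Cexp (Ci * RtoC (t * x)) * f x)%C)).
Proof.
intros HT Hf n; revert f Hf; induction n as [|n IH]; intros f Hf; [split; exact I|].
assert (Hf' : schwartz (fun x => (Ci * (RtoC x * f x))%C))
  by apply schwartz_scale, schwartz_RtoC_mult, Hf.
assert (D := fun t => is_Cderive_weak_char T f t HT Hf).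
destruct (IH _ Hf') as [IH1 IH2]; split.
- eexists; split; [|exact IH1]; intros t _; apply D.
- eexists; split; [|exact IH2]; intros t _; apply D.
Qed.

(** * Branches of the logarithm *)

(* Meaningful only on the half-plane [0 < Re z]. *)
Definition Clog (z : C) : C := (/ 2 * ln (Re z * Re z + Im z * Im z), atan (Im z * / Re z)).

(** For [z = u + iv] with [u > 0] the modulus is [u sqrt(1 + (v/u)^2)], and this root cancels the
    denominator in the cosine and sine of [atan (v/u)]. *)
Lemma Cexp_Clog (z : C) : 0 < Re z -> Cexp (Clog z) = z.
Proof.
intros Hz; unfold Cexp, Clog; simpl.
set (u := Re z) in *; set (v := Im z).
assert (Hs : 0 < u * u + v * v) by nra.
change (exp (/ 2 * ln (u * u + v * v))) with (Rpower (u * u + v * v) (/ 2)).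
rewrite Rpower_sqrt, cos_atan, sin_atan by exact Hs.
assert (HS : 0 < sqrt (1 + Rsqr (v * / u))).
{ apply sqrt_lt_R0; assert (H := Rle_0_sqr (v * / u)); lra. }
replace (sqrt (u * u + v * v)) with (u * sqrt (1 + Rsqr (v * / u))).
- apply Ceq; simpl; fold u v; field; lra.
- rewrite <- (sqrt_Rsqr u) at 1 by lra.
  rewrite <- sqrt_mult; [|apply Rle_0_sqr | assert (H := Rle_0_sqr (v * / u)); lra].
  f_equal; unfold Rsqr; field; lra.
Qed.

Lemma Cexp_surj (z : C) : z <> RtoC 0 -> exists c, Cexp c = z.
Proof.
intros Hz.
(* Adding [i pi/2] to a logarithm multiplies its exponential by [i]; at most three such quarter
   turns reach [z] from the right half-plane. *)
assert (R1 : forall w, (exists c, Cexp c = w) -> exists c, Cexp c = (Ci * w)%C).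
{ intros w [c <-]; exists (Ci * RtoC (PI / 2) + c)%C.
  rewrite Cexp_plus, Cexp_Ci, cos_PI2, sin_PI2; reflexivity. }
assert (P : forall w, 0 < Re w -> exists c, Cexp c = w)
  by (intros w Hw; exists (Clog w); apply Cexp_Clog, Hw).
destruct z as [a b].
destruct (Rtotal_order a 0) as [Ha|[Ha|Ha]].
- replace (a, b) with (Ci * (Ci * (Ropp a, Ropp b)))%C by (apply Ceq; simpl; ring).
  do 2 apply R1; apply P; simpl; lra.
- destruct (Rtotal_order b 0) as [Hb|[Hb|Hb]].
  + replace (a, b) with (Ci * (Ci * (Ci * (Ropp b, a))))%C by (apply Ceq; simpl; ring).
    do 3 apply R1; apply P; simpl; lra.
  + exfalso; apply Hz; rewrite Ha, Hb; reflexivity.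
  + replace (a, b) with (Ci * (b, Ropp a))%C by (apply Ceq; simpl; ring).
    apply R1; apply P; simpl; lra.
- apply P; simpl; lra.
Qed.

(** Equal moduli force equal real parts, and what remains says that the imaginary parts differ by a
    multiple of [2 pi], expressed through cosine and sine. *)
Lemma Cexp_eq (z w : C) : Cexp z = Cexp w ->
  Re z = Re w /\ cos (Im z - Im w) = 1 /\ sin (Im z - Im w) = 0.
Proof.
intros H; unfold Cexp in H; injection H as H1 H2.
assert (E1 := sin2_cos2 (Im z)); assert (E2 := sin2_cos2 (Im w)); unfold Rsqr in E1, E2.
assert (P1 := exp_pos (Re z)); assert (P2 := exp_pos (Re w)).
assert (E : exp (Re z) = exp (Re w)).
{ assert (exp (Re z) * exp (Re z) = exp (Re w) * exp (Re w)); [|nra].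
  transitivity ((exp (Re z) * cos (Im z)) * (exp (Re z) * cos (Im z))
    + (exp (Re z) * sin (Im z)) * (exp (Re z) * sin (Im z))).
  - transitivity (exp (Re z) * exp (Re z) *
      (sin (Im z) * sin (Im z) + cos (Im z) * cos (Im z))); [rewrite E1 |]; ring.
  - rewrite H1, H2; transitivity (exp (Re w) * exp (Re w) *
      (sin (Im w) * sin (Im w) + cos (Im w) * cos (Im w))); [|rewrite E2]; ring. }
rewrite E in H1, H2.
apply Rmult_eq_reg_l in H1; [|lra]; apply Rmult_eq_reg_l in H2; [|lra].
split; [apply exp_inv, E|].
rewrite cos_minus, sin_minus, H1, H2; split; lra.
Qed.

(** [1 - cos y = 2 sin^2(y/2)], and the sine has no other zero in this range. *)
Lemma cos_eq_1_small (y : R) : Rabs y < 1 -> cos y = 1 -> y = 0.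
Proof.
intros Hy Hc; apply Rabs_def2 in Hy.
replace y with (2 * (y / 2)) in Hc by field; rewrite cos_2a_sin in Hc.
assert (Hs : sin (y / 2) = 0) by nra.
assert (HPI := PI2_1).
destruct (Rtotal_order y 0) as [H|[H|H]]; [exfalso|exact H|exfalso].
- assert (0 < sin (- (y / 2))) by (apply sin_gt_0; lra).
  rewrite sin_neg in *; lra.
- assert (0 < sin (y / 2)) by (apply sin_gt_0; lra); lra.
Qed.

(** Near 0 the real parts agree, while the difference of the imaginary parts is continuous at 0 with
    values in the multiples of [2 pi]. Once it moves by less than 1 it cannot move at all. *)
Lemma weak_cgf_unique (phi K L : R -> C) : is_weak_cgf phi K -> is_weak_cgf phi L ->
  exists c, locally 0 (fun t => K t = (L t + c)%C).
Proof.
intros HK HL; exists (K 0 - L 0)%C.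
destruct (locally_singleton _ _ HK) as [KC KE], (locally_singleton _ _ HL) as [LC LE].
assert (D : continuous (fun t => Im (K t) - Im (L t)) 0).
{ apply (continuous_minus (fun t => Im (K t)) (fun t => Im (L t)));
    [apply (continuous_comp K Im) | apply (continuous_comp L Im)]; try assumption;
    [destruct (K 0) | destruct (L 0)]; apply continuous_snd. }
apply filterlim_locally with (eps := mkposreal 1 Rlt_0_1) in D.
assert (E0 : Cexp (K 0) = Cexp (L 0)) by congruence.
apply Cexp_eq in E0; destruct E0 as [R0 [C0 S0]].
generalize (filter_and _ _ D (filter_and _ _ HK HL)); apply filter_imp.
intros t [Dt [[_ Kt] [_ Lt]]].
assert (E : Cexp (K t) = Cexp (L t)) by congruence.
apply Cexp_eq in E; destruct E as [Rt [Ct St]].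
assert (Z : (Im (K t) - Im (L t)) - (Im (K 0) - Im (L 0)) = 0).
{ apply cos_eq_1_small; [exact Dt|].
  rewrite cos_minus, C0, S0, Ct; ring. }
apply Ceq; simpl; unfold Re, Im in *; lra.
Qed.

(** Dividing by [phi 0] gives [psi] with [psi 0 = 1], so near 0 its values lie in the right
    half-plane, where [Clog] is smooth. A logarithm [c] of [phi 0] is added back. *)
Lemma smooth_weak_cgf (phi : R -> C) : Csmooth_on (fun _ => True) phi -> phi 0 <> RtoC 0 ->
  exists K U, is_weak_cgf phi K /\ open U /\ U 0 /\ Csmooth_on U K.
Proof.
intros Hphi H0.
destruct (Cexp_surj _ H0) as [c Hc].
set (psi := fun t => (phi t * / phi 0)%C).
assert (Hpsi : Csmooth_on (fun _ => True) psi)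
  by (apply Csmooth_on_mult; [exact Hphi | apply Csmooth_on_const]).
set (U := fun t => 0 < Re (psi t)).
assert (HU : open U).
{ apply (open_comp (fun t => Re (psi t)) (fun u => 0 < u)); [|apply open_gt].
  intros t _; destruct (Hpsi 1%nat) as [[f' [Hf' _]] _].
  apply (ex_derive_continuous (fun t => Re (psi t))); exists (f' t); apply Hf'; exact I. }
assert (U0 : U 0).
{ unfold U, psi; rewrite Cinv_r by exact H0; simpl; lra. }
set (K := fun t => (c + Clog (psi t))%C).
assert (HK : Csmooth_on U K).
{ assert (HpsiU : forall n, differentiable_on U n (fun t => Re (psi t)) /\
    differentiable_on U n (fun t => Im (psi t))).
  { intros n; destruct (Hpsi n); split;
      apply (differentiable_on_subset (fun _ => True)); auto. }
  intros n; destruct (HpsiU n) as [Hu Hv]; split.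
  - change (differentiable_on U n (fun t => Re c + / 2 *
      ln (Re (psi t) * Re (psi t) + Im (psi t) * Im (psi t)))).
    apply differentiable_on_plus; [apply differentiable_on_const|].
    apply differentiable_on_mult; [apply differentiable_on_const|].
    apply differentiable_on_ln.
    + intros t Ht; unfold U in Ht; nra.
    + apply differentiable_on_plus; apply differentiable_on_mult; assumption.
  - change (differentiable_on U n (fun t => Im c + atan (Im (psi t) * / Re (psi t)))).
    apply differentiable_on_plus; [apply differentiable_on_const|].
    apply differentiable_on_atan, differentiable_on_mult; [assumption|].
    apply differentiable_on_inv; [|assumption].
    intros t Ht; apply Rgt_not_eq, Ht. }
exists K, U; repeat split; try assumption; try apply HK.
apply (locally_open U); [exact HU | | exact U0].
intros t Ht; split.
- destruct (HK 1%nat) as [[f' [Hf' _]] [g' [Hg' _]]].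
  assert (C1 : continuous (fun t => Re (K t)) t)
    by (apply (ex_derive_continuous (fun t => Re (K t))); exists (f' t); auto).
  assert (C2 : continuous (fun t => Im (K t)) t)
    by (apply (ex_derive_continuous (fun t => Im (K t))); exists (g' t); auto).
  apply filterlim_locally; intros eps.
  apply filterlim_locally with (eps := eps) in C1.
  apply filterlim_locally with (eps := eps) in C2.
  generalize (filter_and _ _ C1 C2); apply filter_imp.
  intros s [B1 B2]; split; assumption.
- unfold K; rewrite Cexp_plus, Hc, Cexp_Clog by exact Ht.
  unfold psi; field; exact H0.
Qed.

(** * Weak cumulants *)

(** Every branch is, near 0, the smooth branch plus a constant, hence differentiable; derivatives of
    order at least 1 do not see the constant, so all branches give the value computed from [K]. *)
Lemma is_weak_cumulant_cgf (phi K : R -> C) (n : nat) : (1 <= n)%nat ->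
  Csmooth_on (fun _ => True) phi -> phi 0 <> RtoC 0 -> is_weak_cgf phi K ->
  is_weak_cumulant phi n (/ Cpow Ci n * Cderive_n K n 0)%C.
Proof.
intros Hn Hphi H0 HK; split; [exists K; exact HK|].
intros L HL; split.
- destruct (smooth_weak_cgf phi Hphi H0) as [K0 [U [HK0 [HU [U0 HS]]]]].
  destruct (weak_cgf_unique _ _ _ HL HK0) as [c Hc].
  (* Derivatives are wanted at all [t] near 0, so the two branches must differ by [c] around each
     such [t]. *)
  apply locally_locally in Hc.
  generalize (filter_and _ _ Hc (locally_open U U HU (fun _ h => h) 0 U0)); apply filter_imp.
  intros t [Et Ut] m _.
  destruct (HS m) as [H1 H2].
  split.
  + apply ex_derive_n_ext_loc with (fun s => Re (K0 s) + Re c).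
    * generalize Et; apply filter_imp; intros s ->; reflexivity.
    * apply (differentiable_on_ex_derive_n U m HU); [|exact Ut].
      apply differentiable_on_plus; [exact H1 | apply differentiable_on_const].
  + apply ex_derive_n_ext_loc with (fun s => Im (K0 s) + Im c).
    * generalize Et; apply filter_imp; intros s ->; reflexivity.
    * apply (differentiable_on_ex_derive_n U m HU); [|exact Ut].
      apply differentiable_on_plus; [exact H2 | apply differentiable_on_const].
- destruct (weak_cgf_unique _ _ _ HK HL) as [c Hc]; f_equal.
  (* True for every [f], because [f] and [f + a] have the same difference quotients; [n >= 1] enters
     here. *)
  assert (E : forall (f : R -> R) (a : R), Derive_n (fun t => f t + a) n 0 = Derive_n f n 0).
  { intros f a; destruct n as [|n]; [lia|].
    replace (S n) with (n + 1)%nat by lia; rewrite <- !Derive_n_comp.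
    apply Derive_n_ext; intros t; unfold Derive_n, Derive; do 2 f_equal.
    apply functional_extensionality; intros h; f_equal; ring. }
  unfold Cderive_n; f_equal.
  + rewrite <- (E (fun t => Re (L t)) (Re c)); apply Derive_n_ext_loc.
    generalize Hc; apply filter_imp; intros s ->; reflexivity.
  + rewrite <- (E (fun t => Im (L t)) (Im c)); apply Derive_n_ext_loc.
    generalize Hc; apply filter_imp; intros s ->; reflexivity.
Qed.

Lemma weak_cumulant_cgf (phi K : R -> C) (n : nat) :
  ex_weak_cumulant phi n -> is_weak_cgf phi K ->
  weak_cumulant phi n = (/ Cpow Ci n * Cderive_n K n 0)%C.
Proof.
intros Hex HK.
exact (proj2 (proj2 (epsilon_spec (inhabits (RtoC 0)) _ Hex) K HK)).
Qed.

Lemma is_weak_cgf_plus (phi psi K L : R -> C) : is_weak_cgf phi K -> is_weak_cgf psi L ->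
  is_weak_cgf (fun t => (phi t * psi t)%C) (fun t => (K t + L t)%C).
Proof.
unfold is_weak_cgf; intros HK HL; generalize (filter_and _ _ HK HL); apply filter_imp.
intros t [[CK EK] [CL EL]]; split.
- exact (continuous_plus (V := C_R_NormedModule) K L t CK CL).
- rewrite Cexp_plus, EK, EL; reflexivity.
Qed.

(** The integrand [e^{it(x+y)}] times the test function splits into a function of [x] times a
    function of [y], on which the tensor product is multiplicative. *)
Lemma weak_char_sum_independent (X Y : grv) (J : grv2) (t : R) : independent J X Y ->
  weak_char_sum J t = (weak_char X t * weak_char Y t)%C.
Proof.
intros [[_ HT] Htest]; unfold weak_char, weak_char_sum.
rewrite <- HT; [|apply schwartz_Cexp, grv_test_schwartz ..].
f_equal; apply functional_extensionality; intros x; apply functional_extensionality; intros y.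
rewrite Htest, Rmult_plus_distr_l, Cexp_Ci_plus; ring.
Qed.

Theorem corollary3p6 :
  forall (X Y : grv) (J : grv2),
    independent J X Y ->
    weak_char X 0 <> RtoC 0 ->
    weak_char Y 0 <> RtoC 0 ->
    forall n : nat, (1 <= n)%nat ->
      (ex_weak_cumulant (weak_char X) n /\
       ex_weak_cumulant (weak_char Y) n /\
       ex_weak_cumulant (weak_char_sum J) n) /\
      weak_cumulant (weak_char_sum J) n =
        (weak_cumulant (weak_char X) n + weak_cumulant (weak_char Y) n)%C.
Proof.
intros X Y J HJ HX0 HY0 n Hn.
replace (weak_char_sum J) with (fun t => (weak_char X t * weak_char Y t)%C).
2: { apply functional_extensionality; intros t; symmetry.
     apply weak_char_sum_independent, HJ. }
assert (SX : Csmooth_on (fun _ => True) (weak_char X))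
  by (apply Csmooth_weak_char; [apply grv_dist_tempered | apply grv_test_schwartz]).
assert (SY : Csmooth_on (fun _ => True) (weak_char Y))
  by (apply Csmooth_weak_char; [apply grv_dist_tempered | apply grv_test_schwartz]).
destruct (smooth_weak_cgf _ SX HX0) as [K [_ [HK _]]].
destruct (smooth_weak_cgf _ SY HY0) as [L [_ [HL _]]].
assert (HKL := is_weak_cgf_plus _ _ _ _ HK HL).
assert (CX := is_weak_cumulant_cgf _ _ n Hn SX HX0 HK).
assert (CY := is_weak_cumulant_cgf _ _ n Hn SY HY0 HL).
assert (CXY := is_weak_cumulant_cgf _ _ n Hn (Csmooth_on_mult _ _ _ SX SY)
  (Cmult_neq_0 _ _ HX0 HY0) HKL).
split; [repeat split; eexists; eassumption|].
rewrite (weak_cumulant_cgf _ _ _ (ex_intro _ _ CX) HK),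
  (weak_cumulant_cgf _ _ _ (ex_intro _ _ CY) HL),
  (weak_cumulant_cgf _ _ _ (ex_intro _ _ CXY) HKL).
(* With the common factor [i^{-n}] removed, additivity of the [n]-th derivative at 0 remains. The
   differentiability near 0 that it requires is part of [CX] and [CY]. *)
rewrite <- Cmult_plus_distr_l; f_equal.
destruct (proj2 CX K HK) as [DK _], (proj2 CY L HL) as [DL _].
unfold Cderive_n; apply Ceq.
- apply (Derive_n_plus (fun t => Re (K t)) (fun t => Re (L t))).
  + generalize DK; apply filter_imp; intros t H m Hm; apply H, Hm.
  + generalize DL; apply filter_imp; intros t H m Hm; apply H, Hm.
- apply (Derive_n_plus (fun t => Im (K t)) (fun t => Im (L t))).
  + generalize DK; apply filter_imp; intros t H m Hm; apply H, Hm.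
  + generalize DL; apply filter_imp; intros t H m Hm; apply H, Hm.
Qed.
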